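(* Let $R$ be a commutative ring with nonzero identity, $S$ a multiplicatively closed subset of $R$, $\delta$ an expansion function of $\mathcal{I}(R)$, and suppose that $J(S^{-1}R)=S^{-1}J(R)$. Then: (1) If $I$ is a $\delta$-$J$-ideal of $R$ with $I\cap S=\emptyset$, then $S^{-1}I$ is a $\delta_{S}$-$J$-ideal of $S^{-1}R$. (2) Let $I$ be an ideal of $R$ with $S\cap Z_{J(R)}(R)=S\cap Z_{\delta(I)}(R)=\emptyset$. If $S^{-1}I$ is a $\delta_{S}$-$J$-ideal of $S^{-1}R$, then $I$ is a $\delta$-$J$-ideal of $R$.
   Context: For a ring $R$, $\mathcal{I}(R)$ is the set of all ideals of $R$ and $J(R)$ is the Jacobson radical of $R$. An expansion function of $\mathcal{I}(R)$ is a function $\delta:\mathcal{I}(R)\to\mathcal{I}(R)$ such that $I\subseteq\delta(I)$ for every ideal $I$, and $I\subseteq K$ implies $\delta(I)\subseteq\delta(K)$ for all ideals $I,K$. A proper ideal $I$ of $R$ is a $\delta$-$J$-ideal if whenever $a,b\in R$ and $ab\in I$, then $a\in J(R)$ or $b\in\delta(I)$. $S^{-1}R$ is the ring of fractions of $R$ with respect to $S$, and $\delta_{S}$ denotes the expansion function of $\mathcal{I}(S^{-1}R)$ given by $\delta_{S}(S^{-1}I)=S^{-1}(\delta(I))$ (it is taken as given that this is an expansion function). For an ideal $I$ of $R$, $Z_{I}(R)=\{r\in R \mid rs\in I \text{ for some } s\in R\setminus I\}$. *)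

(* Defs.v *)
From HB Require Import structures.
From mathcomp Require Import all_boot all_algebra generic_quotient.
From mathcomp Require Import boolp classical_sets.
From mathcomp Require Import ring.

Set Implicit Arguments.
Unset Strict Implicit.
Unset Printing Implicit Defensive.

Import GRing.Theory.
Local Open Scope quotient_scope.
Local Open Scope classical_set_scope.
Local Open Scope ring_scope.

(* [idealr_closed] of ring_quotient excludes the unit ideal, which is needed
   here: expansion functions are defined on all ideals and may take the value R.
   [comPzRingType] is used instead of [comNzRingType] because a ring of
   fractions is the zero ring when 0 is a denominator. *)
Record ideal (R : comPzRingType) := Ideal {
  ideal_set :> set R;
  ideal0 : ideal_set 0;
  idealD : forall x y, ideal_set x -> ideal_set y -> ideal_set (x + y);
  idealMl : forall a x, ideal_set x -> ideal_set (a * x)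
}.

Lemma ideal_ext (R : comPzRingType) (I K : ideal R) :
  I = K <-> (I : set R) = K.
Proof.
split=> [->//|]; case: I K => [I I0 ID IM] [K K0 KD KM] /= IK; subst K.
by congr Ideal; apply: Prop_irrelevance.
Qed.

Section IdealTheory.
Variable R : comPzRingType.
Implicit Types I K M : ideal R.

Definition is_proper I := (I : set R) <> setT.

Definition maximal_ideal M :=
  is_proper M /\ forall K, M `<=` K -> is_proper K -> K = M.

Definition jacobson_set : set R :=
  [set x | forall M, maximal_ideal M -> ideal_set M x].

Lemma jacobson0 : jacobson_set 0.
Proof. by move=> M _; apply: ideal0. Qed.

Lemma jacobsonD x y : jacobson_set x -> jacobson_set y -> jacobson_set (x + y).
Proof. by move=> Jx Jy M maxM; apply: idealD; [apply: Jx|apply: Jy]. Qed.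

Lemma jacobsonMl a x : jacobson_set x -> jacobson_set (a * x).
Proof. by move=> Jx M maxM; apply/idealMl/Jx. Qed.

Definition jacobson : ideal R := Ideal jacobson0 jacobsonD jacobsonMl.

Definition is_expansion (delta : ideal R -> ideal R) :=
  (forall I, I `<=` delta I) /\
  (forall I K, I `<=` K -> delta I `<=` delta K).

Definition delta_J_ideal (delta : ideal R -> ideal R) I :=
  is_proper I /\ forall a b : R,
    ideal_set I (a * b) -> ideal_set jacobson a \/ ideal_set (delta I) b.

Definition Zset I : set R :=
  [set r | exists2 s, ~ ideal_set I s & ideal_set I (r * s)].

End IdealTheory.

(* The ring of fractions S^-1 R: pairs (a, s) with s in S, modulo
   (a, s) ~ (b, t) iff u (a t - b s) = 0 for some u in S. *)
Section Localization.
Variables (R : comPzRingType) (S : mulrClosed R).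

Definition denom := {s : R | s \in S}.
Definition denomM (s t : denom) : denom :=
  exist _ (sval s * sval t) (rpredM (valP s) (valP t)).
Definition denom1 : denom := exist _ 1 (rpred1 S).

Local Notation frac := (R * denom)%type.

Definition equivl (x y : frac) : bool :=
  `[< exists2 u, u \in S & u * (x.1 * sval y.2 - y.1 * sval x.2) = 0 >].

Lemma equivl_refl : reflexive equivl.
Proof.
by move=> x; apply/asboolP; exists 1; rewrite ?rpred1 // subrr mulr0.
Qed.

Lemma equivl_sym : symmetric equivl.
Proof.
suff sym x y : equivl x y -> equivl y x.
  by move=> x y; apply/idP/idP; apply: sym.
move=> /asboolP[u Su e]; apply/asboolP; exists u => //.
by rewrite -opprB mulrN e oppr0.
Qed.

Lemma equivl_trans : transitive equivl.
Proof.
move=> y x z /asboolP[u Su exy] /asboolP[v Sv eyz]; apply/asboolP.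
exists (u * v * sval y.2); first by rewrite !rpredM // (valP y.2).
have -> : u * v * sval y.2 * (x.1 * sval z.2 - z.1 * sval x.2) =
  v * sval z.2 * (u * (x.1 * sval y.2 - y.1 * sval x.2)) +
  u * sval x.2 * (v * (y.1 * sval z.2 - z.1 * sval y.2)) by ring.
by rewrite exy eyz !mulr0 addr0.
Qed.

Canonical equivl_equiv := EquivRel equivl equivl_refl equivl_sym equivl_trans.

Definition localization := {eq_quot equivl}.

HB.instance Definition _ : EqQuotient _ equivl localization :=
  EqQuotient.on localization.
HB.instance Definition _ := Choice.on localization.

Definition mkfrac (a : R) (s : denom) : localization := \pi_localization (a, s).

Lemma mkfrac_eqP a b s t :
  mkfrac a s = mkfrac b t <->
  exists2 u, u \in S & u * (a * sval t - b * sval s) = 0.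
Proof. by split=> [/eqmodP/asboolP//|e]; apply/eqmodP/asboolP. Qed.

Lemma mkfracP (z : localization) : exists a s, z = mkfrac a s.
Proof. by elim/quotW: z => -[a s]; exists a, s. Qed.

Let num (z : localization) := (repr z).1.
Let den (z : localization) := (repr z).2.

Let numdenK z : mkfrac (num z) (den z) = z.
Proof. by rewrite /mkfrac /num /den -surjective_pairing reprK. Qed.

Definition loc_add (y z : localization) : localization :=
  mkfrac (num y * sval (den z) + num z * sval (den y)) (denomM (den y) (den z)).
Definition loc_opp (z : localization) : localization :=
  mkfrac (- num z) (den z).
Definition loc_mul (y z : localization) : localization :=
  mkfrac (num y * num z) (denomM (den y) (den z)).

Lemma loc_addE a b s t : loc_add (mkfrac a s) (mkfrac b t) =
  mkfrac (a * sval t + b * sval s) (denomM s t).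
Proof.
rewrite /loc_add.
have /mkfrac_eqP[u Su eu] := numdenK (mkfrac a s).
have /mkfrac_eqP[v Sv ev] := numdenK (mkfrac b t).
move: (num (mkfrac a s)) (den (mkfrac a s)) eu
  (num (mkfrac b t)) (den (mkfrac b t)) ev => a' s' eu b' t' ev.
apply/mkfrac_eqP; exists (u * v); rewrite ?rpredM //=.
rewrite [LHS](_ : _ = v * sval t * sval t' * (u * (a' * sval s - a * sval s')) +
  u * sval s * sval s' * (v * (b' * sval t - b * sval t'))); last by ring.
by rewrite eu ev !mulr0 addr0.
Qed.

Lemma loc_oppE a s : loc_opp (mkfrac a s) = mkfrac (- a) s.
Proof.
rewrite /loc_opp.
have /mkfrac_eqP[u Su eu] := numdenK (mkfrac a s).
apply/mkfrac_eqP; exists u => //.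
by rewrite !mulNr -opprD mulrN eu oppr0.
Qed.

Lemma loc_mulE a b s t :
  loc_mul (mkfrac a s) (mkfrac b t) = mkfrac (a * b) (denomM s t).
Proof.
rewrite /loc_mul.
have /mkfrac_eqP[u Su eu] := numdenK (mkfrac a s).
have /mkfrac_eqP[v Sv ev] := numdenK (mkfrac b t).
move: (num (mkfrac a s)) (den (mkfrac a s)) eu
  (num (mkfrac b t)) (den (mkfrac b t)) ev => a' s' eu b' t' ev.
apply/mkfrac_eqP; exists (u * v); rewrite ?rpredM //=.
rewrite [LHS](_ : _ = v * b' * sval t * (u * (a' * sval s - a * sval s')) +
  u * a * sval s' * (v * (b' * sval t - b * sval t'))); last by ring.
by rewrite eu ev !mulr0 addr0.
Qed.

Let fracE (a b : R) (s t : denom) :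
  a * sval t = b * sval s -> mkfrac a s = mkfrac b t.
Proof.
by move=> e; apply/mkfrac_eqP; exists 1; rewrite ?rpred1 // e subrr mulr0.
Qed.

Lemma loc_addA : associative loc_add.
Proof.
move=> x y z; have [a [s ->]] := mkfracP x; have [b [t ->]] := mkfracP y.
by have [c [u ->]] := mkfracP z; rewrite !loc_addE; apply: fracE => /=; ring.
Qed.

Lemma loc_addC : commutative loc_add.
Proof.
move=> x y; have [a [s ->]] := mkfracP x; have [b [t ->]] := mkfracP y.
by rewrite !loc_addE; apply: fracE => /=; ring.
Qed.

Lemma loc_add0 : left_id (mkfrac 0 denom1) loc_add.
Proof.
move=> x; have [a [s ->]] := mkfracP x.
by rewrite !loc_addE; apply: fracE => /=; ring.
Qed.

Lemma loc_addN : left_inverse (mkfrac 0 denom1) loc_opp loc_add.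
Proof.
move=> x; have [a [s ->]] := mkfracP x.
by rewrite loc_oppE !loc_addE; apply: fracE => /=; ring.
Qed.

HB.instance Definition _ :=
  GRing.isZmodule.Build localization loc_addA loc_addC loc_add0 loc_addN.

Lemma loc_mulA : associative loc_mul.
Proof.
move=> x y z; have [a [s ->]] := mkfracP x; have [b [t ->]] := mkfracP y.
by have [c [u ->]] := mkfracP z; rewrite !loc_mulE; apply: fracE => /=; ring.
Qed.

Lemma loc_mulC : commutative loc_mul.
Proof.
move=> x y; have [a [s ->]] := mkfracP x; have [b [t ->]] := mkfracP y.
by rewrite !loc_mulE; apply: fracE => /=; ring.
Qed.

Lemma loc_mul1 : left_id (mkfrac 1 denom1) loc_mul.
Proof.
move=> x; have [a [s ->]] := mkfracP x.
by rewrite !loc_mulE; apply: fracE => /=; ring.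
Qed.

Lemma loc_mulDl : left_distributive loc_mul loc_add.
Proof.
move=> x y z; have [a [s ->]] := mkfracP x; have [b [t ->]] := mkfracP y.
have [c [u ->]] := mkfracP z; rewrite loc_addE !loc_mulE loc_addE.
by apply: fracE => /=; ring.
Qed.

HB.instance Definition _ := GRing.Zmodule_isComPzRing.Build localization
  loc_mulA loc_mulC loc_mul1 loc_mulDl.

Lemma mkfracD a b s t : mkfrac a s + mkfrac b t =
  mkfrac (a * sval t + b * sval s) (denomM s t).
Proof. exact: loc_addE. Qed.

Lemma mkfracM a b s t : mkfrac a s * mkfrac b t = mkfrac (a * b) (denomM s t).
Proof. exact: loc_mulE. Qed.

Section LocIdeal.
Variable I : ideal R.

Definition loc_ideal_set : set localization :=
  [set z | exists a s, ideal_set I a /\ z = mkfrac a s].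

Lemma loc_ideal0 : loc_ideal_set 0.
Proof. by exists 0, denom1; split; first exact: ideal0. Qed.

Lemma loc_idealD x y :
  loc_ideal_set x -> loc_ideal_set y -> loc_ideal_set (x + y).
Proof.
move=> [a [s [Ia ->]]] [b [t [Ib ->]]]; rewrite mkfracD; do 2!eexists.
by split; last by []; rewrite ![_ * sval _]mulrC; apply: idealD; apply: idealMl.
Qed.

Lemma loc_idealMl c x : loc_ideal_set x -> loc_ideal_set (c * x).
Proof.
move=> [a [s [Ia ->]]]; have [b [t ->]] := mkfracP c; rewrite mkfracM.
by do 2!eexists; split; last by []; apply: idealMl.
Qed.

Definition loc_ideal : ideal localization :=
  Ideal loc_ideal0 loc_idealD loc_idealMl.

End LocIdeal.

(* Every ideal of S^-1 R is of the form S^-1 I, so this determines deltaS. *)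
Definition is_localized_expansion (delta : ideal R -> ideal R)
    (deltaS : ideal localization -> ideal localization) :=
  is_expansion deltaS /\
  forall I, deltaS (loc_ideal I) = loc_ideal (delta I).

End Localization.

(* Main.v *)
Require Import Defs.
From mathcomp Require Import all_boot all_algebra.
From mathcomp Require Import boolp classical_sets.

(** A fraction [a / s] lies in [S^-1 I] exactly when some denominator [u]
    carries its numerator into [I] ([mkfrac_loc_idealP]).  Since both
    [J(S^-1 R)] and [deltaS (S^-1 I)] are localizations of ideals of [R], the
    two J-ideal conditions thus differ only by such factors [u].

    Going up, [(a / s) * (b / t)] in [S^-1 I] means that [u * a * b] is in [I];
    the factor [u] is absorbed into [b], and the condition on [I], applied to
    [a] and [u * b], already gives one of the two required memberships.

    Going down, the condition on [S^-1 I] applied to [a / 1] and [b / 1] gives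
    [u * a] in [J(R)] or [u * b] in [delta I], and [u] can be cancelled because
    no element of [S] is a zero divisor modulo [J(R)] or modulo [delta I]
    ([Zset_disjoint_cancel]). *)

Local Open Scope classical_set_scope.
Local Open Scope ring_scope.

(** The numerator of a fraction is determined only up to factors from [S], so
    [a] itself need not lie in [I]; this states membership in [S^-1 I]
    independently of the chosen representative. *)
Lemma mkfrac_loc_idealP (R : comPzRingType) (S : mulrClosed R) (I : ideal R)
    (a : R) (s : denom S) :
  ideal_set (loc_ideal S I) (mkfrac a s) <->
  exists2 u, u \in S & ideal_set I (u * a).
Proof.
split=> [[b [t [Ib /mkfrac_eqP[v Sv]]]]|[u Su Iua]].
  move/eqP; rewrite GRing.mulrBr GRing.subr_eq0 => /eqP e.
  exists (v * sval t); first by rewrite GRing.rpredM // (valP t).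
  rewrite -GRing.mulrA [sval t * a]GRing.mulrC e [b * _]GRing.mulrC.
  by do 2!apply: idealMl.
exists (u * a), (denomM (exist _ u Su) s); split=> //.
apply/mkfrac_eqP; exists 1; first exact: GRing.rpred1.
by rewrite GRing.mul1r /= GRing.mulrA [a * u]GRing.mulrC GRing.subrr.
Qed.

Lemma loc_ideal_proper (R : comPzRingType) (S : mulrClosed R) (I : ideal R) :
  (I : set R) `&` [set` S] = set0 -> is_proper (loc_ideal S I).
Proof.
move=> IS0 locT.
have : ideal_set (loc_ideal S I) (mkfrac 1 (denom1 S)) by rewrite locT.
move=> /mkfrac_loc_idealP[u Su]; rewrite GRing.mulr1 => Iu.
by have : set0 u by rewrite -IS0.
Qed.

Lemma is_proper_of_loc (R : comPzRingType) (S : mulrClosed R) (I : ideal R) :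
  is_proper (loc_ideal S I) -> is_proper I.
Proof.
move=> properSI IT; apply: properSI; apply/seteqP; split=> // z _.
by have [a [s ->]] := mkfracP z; exists a, s; rewrite IT.
Qed.

Lemma Zset_disjoint_cancel (R : comPzRingType) (A : set R) (K : ideal R)
    (u a : R) :
  A `&` Zset K = set0 -> A u -> ideal_set K (u * a) -> ideal_set K a.
Proof.
move=> AZ0 Au Kua; apply: contrapT => nKa.
by have : set0 u by rewrite -AZ0; split=> //; exists a.
Qed.

Theorem proposition2p8 (R : comNzRingType) (S : mulrClosed R)
    (delta : ideal R -> ideal R)
    (deltaS : ideal (localization S) -> ideal (localization S))
    (delta_exp : is_expansion delta)
    (deltaS_exp : is_localized_expansion delta deltaS)
    (jacobson_loc : jacobson (localization S) = loc_ideal S (jacobson R)) :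
  (forall I : ideal R,
      delta_J_ideal delta I -> (I : set R) `&` [set` S] = set0 ->
      delta_J_ideal deltaS (loc_ideal S I)) /\
  (forall I : ideal R,
      [set` S] `&` Zset (jacobson R) = set0 ->
      [set` S] `&` Zset (delta I) = set0 ->
      delta_J_ideal deltaS (loc_ideal S I) ->
      delta_J_ideal delta I).
Proof.
have [_ deltaSE] := deltaS_exp.
split=> I.
  move=> [_ JI] IS0; split; first exact: loc_ideal_proper.
  move=> x y; have [a [s ->]] := mkfracP x; have [b [t ->]] := mkfracP y.
  rewrite mkfracM => /mkfrac_loc_idealP[u Su]; rewrite GRing.mulrCA.
  rewrite jacobson_loc deltaSE => /JI[Ja|dub]; [left|right].
    by exists a, s.
  by apply/mkfrac_loc_idealP; exists u.
move=> SJ0 Sd0 [properSI JSI]; split; first exact: is_proper_of_loc properSI.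
move=> a b Iab.
have : ideal_set (loc_ideal S I) (mkfrac a (denom1 S) * mkfrac b (denom1 S)).
  by rewrite mkfracM; exists (a * b), (denomM (denom1 S) (denom1 S)).
move=> /JSI; rewrite jacobson_loc deltaSE.
move=> [] /mkfrac_loc_idealP[u Su uK]; [left|right].
  exact: Zset_disjoint_cancel SJ0 Su uK.
exact: Zset_disjoint_cancel Sd0 Su uK.
Qed.
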